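(* Let $(X,d)$ be a compact metric space and $\phi\colon\mathbb{R}\times X\to X$ a continuous flow. Then $\phi$ is expansive if and only if $\phi$ is $k^*$-expansive, i.e. for every $\epsilon>0$ there is $\delta>0$ such that whenever $d(\phi_{h(t)}(x),\phi_t(y))<\delta$ for all $t\in\mathbb{R}$, for some $x,y\in X$ and $h\in\mathcal{H}$, there exist $s,t_0\in\mathbb{R}$ with $|s|<\epsilon$ and $\phi_{h(t_0)}(x)=\phi_{t_0+s}(y)$.
   Context: $\mathcal{H}$ is the set of increasing homeomorphisms $h\colon\mathbb{R}\to\mathbb{R}$ with $h(0)=0$. For $x,y\in X$ let $d_\phi(x,y)=\inf\{\operatorname{diam}(\phi_{[a,b]}(z)): z\in X,\ a\le b,\ x,y\in\phi_{[a,b]}(z)\}$ if $y\in\phi_{\mathbb{R}}(x)$ and $d_\phi(x,y)=\operatorname{diam}(X)$ otherwise. $\phi$ is expansive if for every $\beta>0$ there is $\delta>0$ such that whenever $d(\phi_{h(t)}(x),\phi_t(y))<\delta$ for all $t\in\mathbb{R}$ and some $h\in\mathcal{H}$, then $d_\phi(x,y)<\beta$. *)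

(* Defs.v *)
From HB Require Import structures.
From mathcomp Require Import all_boot all_order all_algebra.
From mathcomp Require Import all_classical all_reals all_analysis.
Set Implicit Arguments. Unset Strict Implicit. Unset Printing Implicit Defensive.
Import Order.TTheory GRing.Theory Num.Theory.
Import numFieldTopology.Exports numFieldNormedType.Exports.
Local Open Scope classical_set_scope.
Local Open Scope ring_scope.

Definition is_flow (R : realType) (X : metricType R) (phi : R -> X -> X) :=
  [/\ forall x, phi 0 x = x,
      forall s t x, phi (s + t) x = phi s (phi t x)
    & continuous (fun p : R * X => phi p.1 p.2)].

Definition incr_homeo0 (R : realType) (h : R -> R) :=
  [/\ {homo h : x y / x < y},
      continuous h,
      (exists g : R -> R, [/\ cancel h g, cancel g h & continuous g])
    & h 0 = 0].

Definition diam (R : realType) (X : metricType R) (A : set X) : R :=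
  sup [set mdist a b | a in A & b in A].

Definition orbit_seg (R : realType) (X : Type) (phi : R -> X -> X) (a b : R) (z : X)
  : set X := [set phi t z | t in [set t | a <= t <= b]].

Definition dphi (R : realType) (X : metricType R) (phi : R -> X -> X) (x y : X) : R :=
  if `[< exists t, y = phi t x >] then
    inf [set r : R | exists (z : X) (a b : R), [/\ a <= b,
           orbit_seg phi a b z x, orbit_seg phi a b z y
         & r = diam (orbit_seg phi a b z)]]
  else diam [set: X].

Definition expansive (R : realType) (X : metricType R) (phi : R -> X -> X) :=
  forall beta : R, 0 < beta -> exists2 delta : R, 0 < delta &
    forall (x y : X) (h : R -> R), incr_homeo0 h ->
      (forall t, mdist (phi (h t) x) (phi t y) < delta) ->
      dphi phi x y < beta.

Definition kstar_expansive (R : realType) (X : metricType R) (phi : R -> X -> X) :=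
  forall eps : R, 0 < eps -> exists2 delta : R, 0 < delta &
    forall (x y : X) (h : R -> R), incr_homeo0 h ->
      (forall t, mdist (phi (h t) x) (phi t y) < delta) ->
      exists s t0 : R, `|s| < eps /\ phi (h t0) x = phi (t0 + s) y.

(* Main.v *)
(** Either notion isolates the fixed points: an orbit staying in a small
    neighbourhood of a fixed point is that fixed point.  By compactness, an arc
    of small diameter and time length bounded below starts near a fixed point.

    Expansive implies k*-expansive: if the conclusion fails for eps, then every
    point of the orbit of x lies on an arc of time length at least eps and
    small diameter, so the whole orbit stays near a single fixed point, and x
    is fixed.

    k*-expansive implies expansive: x and y lie on one orbit, say y = phi_k(x),
    and the arc between times h(t) and t + k is short for t = t0.  There is a
    gap in diameters: an arc whose endpoints are very close has either very
    small diameter or diameter above a fixed b/2.  The diameter of the arc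
    varies continuously with t while its endpoints stay close, so it remains
    small down to t = 0. *)

Require Import Defs.
From mathcomp Require Import all_boot all_order all_algebra.
From mathcomp Require Import all_classical all_reals all_analysis.
From mathcomp Require Import lra.
Import Order.TTheory GRing.Theory Num.Theory.
Import numFieldTopology.Exports numFieldNormedType.Exports.
Local Open Scope classical_set_scope.
Local Open Scope ring_scope.

(** * Connectedness, compactness and real segments *)

(** Both [P] and its negation define open sets, and the line is connected. This carries a property
    of one time to all times. *)
Lemma locally_invariant_pred (R : realType) (P : R -> Prop) :
  (forall t, exists2 r : R, 0 < r & forall t', `|t - t'| < r -> (P t <-> P t')) ->
  forall a b, P a -> P b.
Proof.
move=> locP a b Pa.
have openP (Q : R -> Prop) :
    (forall t, exists2 r : R, 0 < r & forall t', `|t - t'| < r -> (Q t <-> Q t')) ->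
    open [set t | Q t].
  move=> locQ; rewrite openE => t Qt; have [r r0 rQ] := locQ t.
  by apply/nbhs_ballP; exists r => //= t' tt'; apply/rQ.
have /connected_intervalP cR : is_interval [set: R] by [].
suff PT : [set t | P t] = [set: R] by have : [set t | P t] b by rewrite PT.
have {}Pa : [set t | P t] a by [].
apply: cR; first by exists a.
- by exists [set t | P t]; [exact: openP|rewrite setTI].
- exists [set t | P t]; last by rewrite setTI.
  rewrite -[X in closed X]setCK; apply: open_closedC.
  apply: (openP (fun t => ~ P t)) => t.
  have [r r0 rP] := locP t; exists r => // t' /rP[Ptt' Pt't].
  by split=> nP ?; apply: nP; auto.
Qed.

(** Local radii shrink to one value valid on all of [K], since [P] persists when its parameter
    decreases. *)
Lemma compact_uniform_radius (R : realType) (Y : pseudoMetricType R)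
    (K : set Y) (P : R -> Y -> Prop) :
  compact K ->
  (forall r s y, 0 < s -> s <= r -> P r y -> P s y) ->
  (forall y, K y -> exists2 r : R, 0 < r & forall y', ball y r y' -> P r y') ->
  exists2 r : R, 0 < r & forall y, K y -> P r y.
Proof.
move=> /compact_near_coveringP cK monoP locP.
have near0 : \forall r \near 0^'+, K `<=` P r.
  apply: cK => y Ky; have [r r0 rP] := locP y Ky.
  exists (ball y r, [set s | 0 < s <= r]) => /=.
    split; first exact: nbhsx_ballx.
    near=> s; apply/andP; split; [near: s; exact: nbhs_right_gt|].
    by near: s; apply: nbhs_right_le.
  by case=> y' s [/= /rP Py' /andP[s0 sr]]; exact: monoP Py'.
have [r [r0 rP]] : exists r : R, 0 < r /\ K `<=` P r.
  apply: (@filter_ex _ (0 : R)^'+); near=> s; split; last by near: s.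
  by near: s; exact: nbhs_right_gt.
by exists r.
Unshelve. all: end_near. Qed.

Lemma dist_lt_in_segment {R : realType} (a b v w r : R) : `|a - b| < r ->
  Num.min a b <= v <= Num.max a b -> Num.min a b <= w <= Num.max a b ->
  `|v - w| < r.
Proof.
rewrite !ltr_norml => /andP[? ?].
by have [ab|ba] := leP a b => /andP[? ?] /andP[? ?]; apply/andP; split; lra.
Qed.

(** The witness is [v] clamped to the segment between [a] and [b]. *)
Lemma segment_perturb {R : realType} (a b a' b' v r : R) :
  `|a - a'| < r -> `|b - b'| < r -> Num.min a' b' <= v <= Num.max a' b' ->
  exists2 w, Num.min a b <= w <= Num.max a b & `|v - w| < r.
Proof.
move=> aa' bb' v_in.
have r0 : 0 < r by exact: le_lt_trans (normr_ge0 _) aa'.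
move: aa' bb' v_in; rewrite !ltr_norml ge_min le_max.
move=> /andP[a1 a2] /andP[b1 b2] /andP[/orP v1 /orP v2].
have min_max : Num.min a b <= Num.max a b by rewrite le_max ge_min lexx.
have [v_lt|v_ge] := ltP v (Num.min a b).
  exists (Num.min a b); first by rewrite lexx.
  rewrite ltr0_norm; last lra.
  have [m1 m2] : Num.min a b <= a /\ Num.min a b <= b.
    by rewrite !ge_min !lexx orbT.
  by case: v1; lra.
have [v_gt|v_le] := ltP (Num.max a b) v.
  exists (Num.max a b); first by rewrite lexx min_max.
  rewrite gtr0_norm; last lra.
  have [m1 m2] : a <= Num.max a b /\ b <= Num.max a b.
    by rewrite !le_max !lexx orbT.
  by case: v2; lra.
by exists v; rewrite ?v_ge ?v_le // subrr normr0.
Qed.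

(** * Uniform continuity of the flow *)

Section Flow.
Context {R : realType} {X : metricType R} {phi : R -> X -> X}.
Hypotheses (cX : compact [set: X]) (flow : is_flow phi).

Lemma flow0 x : phi 0 x = x. Proof. by case: flow. Qed.

Lemma flowD s t x : phi (s + t) x = phi s (phi t x). Proof. by case: flow. Qed.

Lemma flowK t x : phi (- t) (phi t x) = x.
Proof. by rewrite -flowD addNr flow0. Qed.

Lemma compact_uniform_mdist (P : R -> X -> Prop) :
  (forall r s y, 0 < s -> s <= r -> P r y -> P s y) ->
  (forall y, exists2 r : R, 0 < r & forall y', mdist y y' < r -> P r y') ->
  exists2 r : R, 0 < r & forall y, P r y.
Proof.
move=> monoP locP.
have [y _|r r0 rP] := compact_uniform_radius R X [set: X] P cX monoP.
  by have [r r0 rP] := locP y; exists r => // y'; rewrite ballEmdist; exact: rP.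
by exists r => // y; exact: rP.
Qed.

Lemma flow_continuous_at (t e : R) x : 0 < e ->
  exists2 r : R, 0 < r & forall t' x', `|t - t'| < r -> mdist x x' < r ->
    mdist (phi t x) (phi t' x') < e.
Proof.
move=> e0; case: flow => _ _ /(_ (t, x)) /= ct.
have /ct : nbhs (phi t x) (ball (phi t x) e) by exact: nbhsx_ballx.
move=> /nbhs_ballP[r /= r0 rP]; exists r => // t' x' tt' xx'.
have /= := rP (t', x'); rewrite ballEmdist; apply; split => //=.
by rewrite ballEmdist.
Qed.

Lemma flow_uniform_small_time (e : R) : 0 < e ->
  exists2 r : R, 0 < r & forall s x, `|s| < r -> mdist (phi s x) x < e.
Proof.
move=> e0; have [||r r0 rP] := compact_uniform_mdist
  (fun r x => forall s, `|s| < r -> mdist (phi s x) x < e).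
- by move=> r s y _ sr Pr t ts; apply: Pr; exact: lt_le_trans sr.
- move=> y; have [r r0 rP] := flow_continuous_at 0 (e / 2) y ltac:(lra).
  exists (Num.min r (e / 2)); first by rewrite lt_min r0; lra.
  move=> y'; rewrite lt_min => /andP[yy1 yy2] s; rewrite lt_min => /andP[s1 s2].
  have := rP s y'; rewrite flow0 sub0r normrN => /(_ s1 yy1) H.
  have := metric_triangle (phi s y') y y'; rewrite (metric_sym (phi s y') y).
  lra.
- by exists r => // s x; exact: rP.
Qed.

Lemma flow_uniform_bounded_time (T e : R) : 0 < e ->
  exists2 r : R, 0 < r & forall t x y, `|t| <= T -> mdist x y < r ->
    mdist (phi t x) (phi t y) < e.
Proof.
move=> e0.
have [|||r r0 rP] := compact_uniform_radius R (R * X)%type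
  (`[- T, T] `*` [set: X])
  (fun r p => forall y, mdist p.2 y < r -> mdist (phi p.1 p.2) (phi p.1 y) < e).
- by apply: compact_setX => //; exact: segment_compact.
- by move=> r s y _ sr Pr z zs; apply: Pr; exact: lt_le_trans sr.
- move=> [t x] _; have [r r0 rP] := flow_continuous_at t (e / 2) x ltac:(lra).
  exists (r / 2); first lra.
  case=> t' x' [/= tt']; rewrite ballEmdist /= => xx' y xy.
  have {}tt' : `|t - t'| < r / 2 := tt'.
  have {}tt' : `|t - t'| < r by apply: lt_trans tt' _; lra.
  have H1 : mdist (phi t x) (phi t' x') < e / 2 by apply: rP => //; lra.
  have H2 : mdist (phi t x) (phi t' y) < e / 2.
    by apply: rP => //; have := metric_triangle x x' y; lra.
  have := metric_triangle (phi t' x') (phi t x) (phi t' y).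
  by rewrite (metric_sym (phi t' x') (phi t x)); lra.
- exists r => // t x y tT xy.
  by apply: (rP (t, x)) => //; split => //=; rewrite in_itv /= -ler_norml.
Qed.

(** * Fixed points and arcs of small diameter *)

Definition fixed_point (p : X) := forall t, phi t p = p.

(** A pointwise diameter bound, keeping suprema out of the estimates; it is vacuous if [b < a]. *)
Definition arc_le (x : X) (a b r : R) := forall s t,
  a <= s <= b -> a <= t <= b -> mdist (phi s x) (phi t x) <= r.

Definition near_fixed (r : R) (z : X) := exists2 p, fixed_point p & mdist z p < r.

Definition fixed_isolated (d : R) := forall p y, fixed_point p ->
  (forall t, mdist (phi t y) p < d) -> y = p.

Lemma arc_leW x a b a' b' r r' :
  a <= a' -> b' <= b -> r <= r' -> arc_le x a b r -> arc_le x a' b' r'.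
Proof.
move=> aa bb rr arc s t /andP[? ?] /andP[? ?]; apply: le_trans rr.
by apply: arc; apply/andP; split; lra.
Qed.

Lemma arc_le_shift x c a b r :
  arc_le (phi c x) a b r <-> arc_le x (a + c) (b + c) r.
Proof.
split=> arc s t /andP[? ?] /andP[? ?].
  have := arc (s - c) (t - c); rewrite -!flowD !subrK; apply; lra.
by rewrite -!flowD; apply: arc; lra.
Qed.

(** The set of times at which [z] returns to itself is stable under steps shorter than [e], in both
    directions. *)
Lemma fixed_point_small_time (e : R) z : 0 < e ->
  (forall t, 0 <= t <= e -> phi t z = z) -> fixed_point z.
Proof.
move=> e0 ze t; apply: (locally_invariant_pred R (fun t => phi t z = z) _ 0 t).
  have step s s' : `|s - s'| < e -> phi s z = z -> phi s' z = z.
    rewrite ltr_norml => /andP[? ?] sz.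
    have [le_ss'|lt_s's] := leP s s'.
      by rewrite -(subrK s s') flowD sz; apply: ze; lra.
    rewrite -{1}(subrK s s') flowD sz -[in LHS](ze (s - s')); last by lra.
    by rewrite -(opprB s s') flowK.
  by move=> s; exists e => // s' ss'; split; apply: step; rewrite // distrC.
by rewrite flow0.
Qed.

(** Around a fixed point everything is near it. Around any other [z], the separation above [B]
    persists by continuity and refutes [Q]. Compactness makes [d] uniform. *)
Lemma near_fixed_uniform (r : R) (Q : R -> X -> Prop) : 0 < r ->
  (forall d d' z, 0 < d' -> d' <= d -> Q d' z -> Q d z) ->
  (forall z, ~ fixed_point z -> exists s t B, B < mdist (phi s z) (phi t z) /\
    exists2 d : R, 0 < d & forall z', Q d z' -> mdist (phi s z') (phi t z') <= B) ->
  exists2 d : R, 0 < d & forall z, Q d z -> near_fixed r z.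
Proof.
move=> r0 monoQ farQ.
apply: (compact_uniform_mdist (fun d z => Q d z -> near_fixed r z)).
  by move=> d d' z d'0 dd' H /(monoQ _ _ _ d'0 dd').
move=> z; have [fz|/farQ [s [t [B [Bz [d d0 dQ]]]]]] := pselect (fixed_point z).
  by exists r => // z' zz' _; exists z => //; rewrite metric_sym.
(* Half the excess over [B]: moving both endpoints by less than [e] keeps their distance above
   [B]. *)
set e := (mdist (phi s z) (phi t z) - B) / 2.
have e0 : 0 < e by rewrite /e; lra.
have [r1 r10 r1P] := flow_uniform_bounded_time (Num.max `|s| `|t|) _ e0.
exists (Num.min r1 d); first by rewrite lt_min r10.
move=> z'; rewrite lt_min => /andP[zz' _] Qz'; exfalso.
have Hs : mdist (phi s z) (phi s z') < e by apply: r1P; rewrite // le_max lexx.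
have Ht : mdist (phi t z) (phi t z') < e.
  by apply: r1P; rewrite // le_max lexx orbT.
have {}Qz' : Q d z'.
  by apply: monoQ Qz'; rewrite ?lt_min ?r10 // ge_min lexx orbT.
have := dQ _ Qz'.
have := metric_triangle (phi s z) (phi s z') (phi t z).
have := metric_triangle (phi s z') (phi t z') (phi t z).
rewrite (metric_sym (phi t z')); rewrite /e in Hs Ht; lra.
Qed.

Lemma near_fixed_of_short_arc (e r : R) : 0 < e -> 0 < r ->
  exists2 b : R, 0 < b & forall z, arc_le z 0 e b -> near_fixed r z.
Proof.
move=> e0 r0.
apply: (near_fixed_uniform r (fun b z => arc_le z 0 e b)) => // [d d' z _ dd'|z nfz].
  exact: arc_leW.
have [t te tz] : exists2 t, 0 <= t <= e & phi t z <> z.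
  apply: contrapT => H; apply: nfz; apply: (fixed_point_small_time e) => // t te.
  by apply: contrapT => tz; apply: H; exists t.
have D0 : 0 < mdist (phi t z) (phi 0 z).
  by rewrite mdist_gt0 flow0; apply/eqP.
exists t, 0, (mdist (phi t z) (phi 0 z) / 2); split; first lra.
exists (mdist (phi t z) (phi 0 z) / 2); first lra.
by move=> z' arc; apply: arc => //; rewrite lexx ltW.
Qed.

(** The orbit starts within [d / 2] of a fixed point and moves by at most [d / 3], so it stays
    within [d] and isolation applies. *)
Lemma fixed_of_small_orbit (d : R) : 0 < d -> fixed_isolated d ->
  exists2 b : R, 0 < b <= d / 3 & forall z,
    (forall s t, mdist (phi s z) (phi t z) <= b) -> fixed_point z.
Proof.
move=> d0 isod.
have [b b0 bP] := near_fixed_of_short_arc 1 (d / 2) ltr01 ltac:(lra).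
exists (Num.min b (d / 3)); first by rewrite lt_min b0 ge_min lexx orbT; lra.
move=> z zb.
have [s t _ _|p fp zp] := bP z.
  by have := zb s t; rewrite le_min => /andP[].
suff -> : z = p by [].
apply: isod => // t; have := zb t 0; rewrite flow0 le_min => /andP[_ H].
by have := metric_triangle (phi t z) z p; lra.
Qed.

Lemma near_fixed_of_long_arc (b r : R) : 0 < r ->
  (forall z, (forall s t, mdist (phi s z) (phi t z) <= b) -> fixed_point z) ->
  exists2 T : R, 0 < T & forall z, arc_le z (- T) T b -> near_fixed r z.
Proof.
move=> r0 fixb.
(* The time length is encoded as the inverse of [d], so that the arc condition weakens as [d]
   grows. *)
have [|z nfz|d d0 dP] := near_fixed_uniform r
    (fun d z => arc_le z (- d^-1) d^-1 b) r0; last first.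
- by exists d^-1; rewrite ?invr_gt0.
- have [s [t st]] : exists s t, b < mdist (phi s z) (phi t z).
    apply: contrapT => H; apply: nfz; apply: fixb => s t.
    by rewrite leNgt; apply/negP => st; apply: H; exists s, t.
  exists s, t, b; split => //.
  have T0 : 0 < `|s| + `|t| + 1 by have := normr_ge0 s; have := normr_ge0 t; lra.
  exists (`|s| + `|t| + 1)^-1; first by rewrite invr_gt0.
  move=> z'; rewrite invrK => arc; apply: arc; rewrite -ler_norml.
    by have := normr_ge0 t; lra.
  by have := normr_ge0 s; lra.
- move=> d d' z d'0 dd'; have : d^-1 <= d'^-1 by rewrite lef_pV2 // posrE; lra.
  by move=> ?; apply: arc_leW => //; rewrite lerN2.
Qed.

(** * The gap in diameters *)

Lemma fixed_isolated_eq (d : R) p q : fixed_isolated d ->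
  fixed_point p -> fixed_point q -> mdist p q < d -> p = q.
Proof. by move=> isod fp fq pq; apply: isod => // t; rewrite fp. Qed.

(* If u and phi_T(u) shadow each other for a time T2, then the orbit of u over
   [-T2, T2] follows the arc over [0, T], drifting by eta at each turn. *)
Lemma almost_periodic_near_arc (u : X) (T T2 tau eta : R) :
  0 < tau <= T ->
  (forall s, `|s| <= T2 -> mdist (phi s u) (phi s (phi T u)) <= eta) ->
  forall (j : nat) s, `|s| <= T2 -> - (j%:R * tau) <= s <= T + j%:R * tau ->
    exists2 s', 0 <= s' <= T & mdist (phi s u) (phi s' u) <= j%:R * eta.
Proof.
move=> /andP[tau0 tauT] close; elim=> [|j IH] s sT2.
  by rewrite !mul0r oppr0 addr0 => sT; exists s => //; rewrite mdistxx.
rewrite -natr1 !mulrDl !mul1r => /andP[s1 s2].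
have shift w : phi w (phi T u) = phi (w + T) u by rewrite flowD.
have jt0 : 0 <= j%:R * tau :> R by rewrite mulr_ge0 // ltW.
have eta0 : 0 <= eta by apply: le_trans (close s sT2); exact: mdist_ge0.
have je0 : 0 <= j%:R * eta by rewrite mulr_ge0.
(* Translating [s] by [T] towards [0, T] costs [eta] and, as [tau <= T], gains at least [tau]. *)
have [s0|s0] := leP 0 s; last first.
  have H := close s sT2; rewrite shift in H.
  have [sT0|sT0] := leP 0 (s + T).
    by exists (s + T); [apply/andP; split; lra|lra].
  have [||s' s'T Hs'] := IH (s + T).
  - by move: sT2; rewrite !ler_norml => /andP[? ?]; apply/andP; split; lra.
  - by apply/andP; split; lra.
  exists s' => //.
  by have := metric_triangle (phi s u) (phi (s + T) u) (phi s' u); lra.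
have [sT|sT] := leP s T.
  by exists s; [rewrite s0|rewrite mdistxx; lra].
have sT2' : `|s - T| <= T2.
  by move: sT2; rewrite !ler_norml => /andP[? ?]; apply/andP; split; lra.
have H := close _ sT2'; rewrite shift subrK in H.
have [//||s' s'T Hs'] := IH (s - T); first by apply/andP; split; lra.
exists s' => //.
have := metric_triangle (phi s u) (phi (s - T) u) (phi s' u).
by rewrite (metric_sym (phi s u) (phi (s - T) u)); lra.
Qed.

(* The gap in diameters: the arc over [a, a'] is close to a full orbit of
   diameter at most b, so its endpoints are near a fixed point p.  An inner
   point is at bounded time from an endpoint, hence near p, or is itself near a
   fixed point, which must be p. *)
Lemma closed_up_arc_small (d b c : R) : 0 < d -> fixed_isolated d ->
  0 < b <= d / 3 ->
  (forall z, (forall s t, mdist (phi s z) (phi t z) <= b) -> fixed_point z) ->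
  0 < c ->
  exists2 e : R, 0 < e & forall x a a', a <= a' ->
    mdist (phi a x) (phi a' x) < e -> arc_le x a a' (b / 2) -> arc_le x a a' c.
Proof.
move=> d0 isod /andP[b0 bd] fixb c0.
(* Two points within [c / 4] of a fixed point are within [c / 2] of each other; [d / 6] serves to
   identify two fixed points. *)
pose r := Num.min (c / 4) (d / 6).
have r0 : 0 < r by rewrite lt_min; apply/andP; split; lra.
have [rc rd] : r <= c / 4 /\ r <= d / 6.
  by split; rewrite ge_min lexx ?orbT.
have [T1 T10 T1P] := near_fixed_of_long_arc b r r0 fixb.
have [r1 r10 r1P] := flow_uniform_bounded_time T1 r r0.
pose r2 := Num.min r1 r.
have r20 : 0 < r2 by rewrite lt_min r10.
have [r21 r2r] : r2 <= r1 /\ r2 <= r by split; rewrite ge_min lexx ?orbT.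
have [T2 T20 T2P] := near_fixed_of_long_arc b (r2 / 2) ltac:(lra) fixb.
have [tau tau0 tauP] := flow_uniform_small_time (c / 2) ltac:(lra).
(* [N] turns of length at least [tau] cover the time [T2], and [eta] keeps their total drift below
   [b / 4]. *)
pose N := Num.bound (T2 / tau).
have NT : T2 <= N%:R * tau.
  by rewrite -ler_pdivrMr //; apply: ltW; apply: archi_boundP; rewrite divr_ge0 // ltW.
pose eta := b / 4 / N.+1%:R.
have eta0 : 0 < eta by rewrite divr_gt0 //; lra.
have Neta : N%:R * eta <= b / 4.
  rewrite /eta mulrCA ger_pMr; last lra.
  by rewrite ler_pdivrMr // mul1r ler_nat.
have [e1 e10 e1P] := flow_uniform_bounded_time T2 eta eta0.
exists (Num.min e1 (r2 / 2)); first by rewrite lt_min e10; lra.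
suff main u T : 0 <= T -> mdist u (phi T u) < Num.min e1 (r2 / 2) ->
    arc_le u 0 T (b / 2) -> forall s, 0 <= s <= T -> mdist (phi s u) u <= c / 2.
  move=> x a a' aa' close arc.
  have {}main := main (phi a x) (a' - a) ltac:(lra).
  rewrite -flowD subrK arc_le_shift add0r subrK in main.
  have {}main s : a <= s <= a' -> mdist (phi s x) (phi a x) <= c / 2.
    move=> /andP[? ?]; have := main close arc (s - a).
    by rewrite -flowD subrK; apply; apply/andP; split; lra.
  move=> s t /main Hs /main Ht.
  have := metric_triangle (phi s x) (phi a x) (phi t x).
  by rewrite (metric_sym (phi a x)); lra.
rewrite lt_min => T0 /andP[uT1 uT2] arc s /andP[s0 sT].
(* Arcs shorter than [tau] are small outright; for the others the drift estimate applies. *)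
have [Ttau|tauT] := ltP T tau.
  by apply/ltW/tauP; rewrite ger0_norm //; lra.
have close w : `|w| <= T2 -> mdist (phi w u) (phi w (phi T u)) <= eta.
  by move=> wT2; apply/ltW/e1P.
have nearArc w : - T2 <= w <= T2 ->
    exists2 s', 0 <= s' <= T & mdist (phi w u) (phi s' u) <= b / 4.
  move=> wT2; have [|||s' s'T H] := almost_periodic_near_arc u T T2 tau eta _ close N w.
  - by rewrite tau0.
  - by rewrite ler_norml.
  - by move: wT2 => /andP[? ?]; apply/andP; split; lra.
  - by exists s' => //; lra.
(* Over [-T2, T2] the diameter is at most [b / 4 + b / 2 + b / 4 = b]. *)
have [w w' /nearArc[v vT Hv] /nearArc[v' v'T Hv']|p fp up] := T2P u.
  have := arc v v' vT v'T.
  have := metric_triangle (phi w u) (phi v u) (phi w' u).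
  have := metric_triangle (phi v u) (phi v' u) (phi w' u).
  by rewrite (metric_sym (phi v' u)); lra.
have stay v w : mdist v p < r2 -> `|w| <= T1 -> mdist (phi w v) p < r.
  by move=> vp wT1; rewrite -(fp w); apply: r1P => //; lra.
have su : mdist (phi s u) p < r -> mdist (phi s u) u <= c / 2.
  move=> sp; have := metric_triangle (phi s u) p u.
  by rewrite (metric_sym p u); lra.
have [sT1|T1s] := leP s T1.
  by apply/su/stay; [lra|rewrite ger0_norm].
have [TsT1|T1Ts] := leP (T - s) T1.
  apply: su; rewrite -(subrK T s) flowD; apply: stay.
    have := metric_triangle (phi T u) u p.
    by rewrite (metric_sym (phi T u) u); lra.
  by rewrite distrC ger0_norm //; lra.
(* There is room [T1] on both sides of [s], so this point is near some fixed point [q]; the arc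
   being small, [q] must be [p]. *)
have [|q fq sq] := T1P (phi s u).
  by rewrite arc_le_shift; apply: arc_leW arc; lra.
suff pq : p = q by apply: su; rewrite pq.
apply: (fixed_isolated_eq d) => //.
have := arc s 0; rewrite flow0 s0 sT lexx T0 => /(_ isT isT) H.
have := metric_triangle p u q; have := metric_triangle u (phi s u) q.
by rewrite (metric_sym p u) (metric_sym u (phi s u)); lra.
Qed.

(** * Reparametrizations, diameters and [dphi] *)

Lemma incr_homeo0_id : incr_homeo0 (@id R).
Proof.
split=> //; first by move=> t; exact: cvg_id.
by exists id; split => // t; exact: cvg_id.
Qed.

(** Recentring lets expansivity be applied to the pair [phi (h a) x], [phi a y] at any time [a]. *)
Lemma incr_homeo0_shift (h : R -> R) (a : R) :
  incr_homeo0 h -> incr_homeo0 (fun t => h (t + a) - h a).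
Proof.
move=> [h_lt ch [g [hg gh cg]] h0]; split.
- by move=> s t st; rewrite ltrD2r h_lt // ltrD2r.
- move=> t; apply: cvgB; last exact: cvg_cst.
  apply: continuous_comp; last exact: ch.
  by apply: cvgD; [exact: cvg_id|exact: cvg_cst].
- exists (fun t => g (t + h a) - a); split.
  + by move=> t; rewrite subrK hg addrK.
  + by move=> t; rewrite subrK gh addrK.
  + move=> t; apply: cvgB; last exact: cvg_cst.
    apply: continuous_comp; last exact: cg.
    by apply: cvgD; [exact: cvg_id|exact: cvg_cst].
- by rewrite add0r subrr.
Qed.

Lemma mdist_bounded : exists M : R, forall x y : X, mdist x y <= M.
Proof.
have [[x0]|noX] := pselect (inhabited X); last first.
  by exists 0 => x; case: noX; exists.
have [||r r0 rP] := compact_uniform_mdist (fun r x => mdist x0 x <= r^-1).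
- move=> r s y s0 sr /le_trans; apply.
  by rewrite lef_pV2 // posrE; exact: lt_le_trans sr.
- move=> y; have D0 := mdist_ge0 x0 y.
  have r0 : 0 < (mdist x0 y + 1)^-1 by rewrite invr_gt0; lra.
  (* This radius is at most 1, and its inverse bounds the distance from [x0] throughout the ball. *)
  exists (mdist x0 y + 1)^-1 => // y' yy'; rewrite invrK.
  have : (mdist x0 y + 1)^-1 <= 1 by rewrite invf_le1; lra.
  by have := metric_triangle x0 y y'; lra.
- exists (r^-1 + r^-1) => x y; have := rP x; have := rP y.
  by have := metric_triangle x x0 y; rewrite (metric_sym x x0); lra.
Qed.

Lemma mdist_le_diam (A : set X) x y : A x -> A y -> mdist x y <= diam A.
Proof.
move=> Ax Ay; have [M MP] := mdist_bounded; apply: ub_le_sup.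
  by exists M => _ [u _ [v _ <-]]; exact: MP.
by exists x => //; exists y.
Qed.

Lemma diam_orbit_seg_le x a b r : a <= b -> arc_le x a b r ->
  diam (orbit_seg phi a b x) <= r.
Proof.
move=> ab arc; apply: ge_sup.
  have xa : orbit_seg phi a b x (phi a x) by exists a => //=; rewrite lexx.
  by exists (mdist (phi a x) (phi a x)), (phi a x) => //; exists (phi a x).
by move=> _ [_ [s sab <-] [_ [t tab <-] <-]]; exact: arc.
Qed.

Lemma dphi_le x c r : arc_le x (Num.min 0 c) (Num.max 0 c) r ->
  dphi phi x (phi c x) <= r.
Proof.
move=> arc; rewrite /dphi asboolT; last by exists c.
apply: le_trans (diam_orbit_seg_le _ _ _ _ _ arc); last first.
  by rewrite le_max ge_min lexx.
apply: ge_inf; last first.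
  exists x, (Num.min 0 c), (Num.max 0 c); split => //.
  - by rewrite le_max ge_min lexx.
  - by exists 0; rewrite ?flow0 //= le_max ge_min lexx.
  - by exists c; rewrite //= le_max ge_min lexx !orbT.
exists 0 => _ [z [a [b [ab za _ ->]]]].
by have := mdist_le_diam _ _ _ za za; rewrite mdistxx.
Qed.

(** The bound on [r] excludes the default value of [dphi], so both points lie on one orbit. *)
Lemma dphi_lt_arc x y r : r <= diam [set: X] -> dphi phi x y < r ->
  exists z a b, [/\ phi a z = x, phi b z = y &
    arc_le z (Num.min a b) (Num.max a b) r].
Proof.
move=> rX; rewrite /dphi; case: asboolP => [[c ->]|_]; last lra.
move=> /inf_lt[|_ [z [a [b [ab [s sab sx] [t tab ty] ->]]]] diam_r].
  exists (diam (orbit_seg phi (Num.min 0 c) (Num.max 0 c) x)).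
  exists x, (Num.min 0 c), (Num.max 0 c); split => //.
  - by rewrite le_max ge_min lexx.
  - by exists 0; rewrite ?flow0 //= le_max ge_min lexx.
  - by exists c; rewrite //= le_max ge_min lexx !orbT.
exists z, s, t; split => // v w vst wst.
have inab u : Num.min s t <= u <= Num.max s t -> a <= u <= b.
  move: sab tab => /= /andP[? ?] /andP[? ?].
  rewrite ge_min le_max => /andP[/orP u1 /orP u2]; apply/andP.
  by split; [case: u1; lra|case: u2; lra].
apply/ltW; apply: le_lt_trans diam_r; apply: mdist_le_diam.
  by exists v => //; exact: inab.
by exists w => //; exact: inab.
Qed.

(** * Isolation of fixed points under either notion *)

Lemma fixed_isolated_kstar : kstar_expansive phi ->
  exists2 d : R, 0 < d & fixed_isolated d.
Proof.
move=> kphi; have [d d0 dP] := kphi 1 ltr01; exists d => // p y fp py.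
have [||s [t [_]]] := dP p y id; first exact: incr_homeo0_id.
  by move=> t; rewrite fp metric_sym.
by rewrite fp => pE; rewrite -(flowK (t + s) y) -pE fp.
Qed.

(** Taking [diam [set: X]] as the bound on [dphi] forces [y] onto the orbit of [p], which is a
    single point. *)
Lemma fixed_isolated_expansive : expansive phi -> 0 < diam [set: X] ->
  exists2 d : R, 0 < d & fixed_isolated d.
Proof.
move=> ephi X0; have [d d0 dP] := ephi _ X0; exists d => // p y fp py.
have := dP p y id incr_homeo0_id.
case/(_ _)/dphi_lt_arc => // [t|z [a [b [az bz _]]]].
  by rewrite fp metric_sym.
have pz : z = p by rewrite -(flowK a z) az fp.
by rewrite -bz pz fp.
Qed.

(** * From k*-expansive to expansive *)

Lemma expansive_of_kstar : kstar_expansive phi -> expansive phi.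
Proof.
move=> kphi beta beta0.
have [d d0 isod] := fixed_isolated_kstar kphi.
have [b bd fixb] := fixed_of_small_orbit d d0 isod.
have b0 : 0 < b by case/andP: bd.
pose c := Num.min (beta / 2) (b / 4).
have c0 : 0 < c by rewrite lt_min; apply/andP; split; lra.
have [cbeta cb] : c <= beta / 2 /\ c <= b / 4.
  by split; rewrite ge_min lexx ?orbT.
have [e1 e10 e1P] := closed_up_arc_small d b c d0 isod bd fixb c0.
have [tau tau0 tauP] := flow_uniform_small_time c c0.
have [e2 e20 e2P] := kphi tau tau0.
have [rho rho0 rhoP] := flow_uniform_small_time (b / 8) ltac:(lra).
exists (Num.min e1 e2); first by rewrite lt_min e10.
move=> x y h hH close.
have {}close t : mdist (phi (h t) x) (phi t y) < e1 /\
    mdist (phi (h t) x) (phi t y) < e2.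
  by have := close t; rewrite lt_min => /andP.
have [s [t0 [stau sE]]] := e2P x y h hH (fun t => (close t).2).
pose k := h t0 - t0 - s.
have yE : y = phi k x.
  rewrite -(flowK (t0 + s) y) -sE -flowD /k; congr (phi _ x); lra.
have [_ ch _ h0] := hH.
(* The endpoints of this arc are [phi (h t) x] and [phi t y], always close; at [t = 0] it joins [x]
   to [y]. *)
pose P t := arc_le x (Num.min (h t) (t + k)) (Num.max (h t) (t + k)) c.
have P0 : P 0.
  apply: (locally_invariant_pred R P _ t0 0) => [|v w v_in w_in]; last first.
    have -> : v = v - w + w by lra.
    rewrite flowD; apply/ltW/tauP/(dist_lt_in_segment (h t0) (t0 + k)) => //.
    by have -> : h t0 - (t0 + k) = s by rewrite /k; lra.
  (* A small change of time raises the diameter from [c <= b / 4] to at most [b / 2]; the gap brings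
     it back to [c]. *)
  have step t t' : `|t - t'| < rho -> `|h t - h t'| < rho -> P t -> P t'.
    move=> tt' htt' Pt.
    have arc : arc_le x (Num.min (h t') (t' + k)) (Num.max (h t') (t' + k)) (b / 2).
      have clamp v : Num.min (h t') (t' + k) <= v <= Num.max (h t') (t' + k) ->
          exists2 w, Num.min (h t) (t + k) <= w <= Num.max (h t) (t + k) &
            mdist (phi v x) (phi w x) < b / 8.
        move=> v_in.
        have [|w w_in vw] := segment_perturb _ (t + k) _ _ v _ htt' _ v_in.
          by have -> : t + k - (t' + k) = t - t' by lra.
        exists w => //; have -> : v = v - w + w by lra.
        by rewrite flowD; exact: rhoP.
      move=> v v' /clamp[w w_in vw] /clamp[w' w'_in v'w'].
      have := Pt w w' w_in w'_in.
      have := metric_triangle (phi v x) (phi w x) (phi v' x).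
      have := metric_triangle (phi w x) (phi w' x) (phi v' x).
      by rewrite (metric_sym (phi w' x)); lra.
    have [cl _] := close t'; rewrite yE -flowD in cl.
    apply: e1P => //; first by rewrite le_max ge_min lexx.
    rewrite /Num.min /Num.max; case: ifPn => // _.
    by rewrite metric_sym.
  move=> t; have /ch : nbhs (h t) (ball (h t) rho) by exact: nbhsx_ballx.
  move=> /nbhs_ballP[r /= r0 rP].
  exists (Num.min rho r); first by rewrite lt_min rho0.
  move=> t'; rewrite lt_min => /andP[tt' /rP htt'].
  have {}htt' : `|h t - h t'| < rho := htt'.
  by split; apply: step; rewrite // distrC.
have : dphi phi x y <= c.
  by rewrite yE; apply: dphi_le; rewrite /P h0 add0r in P0.
lra.
Qed.

(** * From expansive to k*-expansive *)

Lemma kstar_of_expansive : expansive phi -> kstar_expansive phi.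
Proof.
move=> ephi eps eps0.
have [[x0 [y0 xy0]]|trivX] := pselect (exists x y : X, x <> y); last first.
  exists 1 => // x y h _ _; exists 0, 0; split; first by rewrite normr0.
  by apply: contrapT => xy; apply: trivX; exists (phi (h 0) x), (phi (0 + 0) y).
have X0 : 0 < diam [set: X].
  apply: lt_le_trans (mdist_le_diam [set: X] x0 y0 I I).
  by rewrite mdist_gt0; apply/eqP.
have [d d0 isod] := fixed_isolated_expansive ephi X0.
have [b b0 bP] := near_fixed_of_short_arc eps (d / 12) eps0 ltac:(lra).
pose c := Num.min (Num.min b (d / 12)) (diam [set: X]).
have c0 : 0 < c by rewrite !lt_min b0 X0 !andbT; lra.
have [[cb cd] cX'] : (c <= b /\ c <= d / 12) /\ c <= diam [set: X].
  by do !split; rewrite !ge_min lexx ?orbT.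
have [e e0 eP] := ephi c c0; exists e => // x y h hH close.
have arcs t : exists z a a', [/\ phi a z = phi (h t) x, phi a' z = phi t y &
    arc_le z (Num.min a a') (Num.max a a') c].
  apply: dphi_lt_arc => //; apply: eP (incr_homeo0_shift h t hH) _ => u.
  by rewrite -!flowD subrK.
apply: contrapT => no_s.
(* If the times [a] and [a'] were closer than [eps], the orbits would meet as required; so the arc
   lasts at least [eps]. As [h] is onto, every time [t] is reached. *)
have near_fix t : near_fixed (d / 6) (phi t x).
  have [_ _ [g [_ gh _]] _] := hH.
  have [z [a [a' [az a'z arc]]]] := arcs (g t); rewrite gh in az.
  have aa' : eps <= `|a - a'|.
    rewrite leNgt; apply/negP => small; apply: no_s.
    exists (a - a'), (g t); split => //.
    by rewrite gh addrC flowD -a'z -flowD subrK.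
  set m := Num.min a a'.
  have [|p fp pz] := bP (phi m z).
    rewrite arc_le_shift; apply: arc_leW cb arc; first by rewrite add0r.
    move: aa'; rewrite /m /Num.min /Num.max.
    case: ifPn => [lt_aa'|]; first by rewrite distrC gtr0_norm; lra.
    by rewrite -leNgt => le_a'a; rewrite ger0_norm; lra.
  exists p => //; rewrite -az.
  have : mdist (phi a z) (phi m z) <= c.
    by apply: arc; rewrite ?lexx ge_min le_max ?ge_min lexx.
  by have := metric_triangle (phi a z) (phi m z) p; lra.
have [p fp xp] := near_fix 0.
have [rho rho0 rhoP] := flow_uniform_small_time (d / 6) ltac:(lra).
have stay t : mdist (phi t x) p < d / 6.
  apply: (locally_invariant_pred R (fun t => mdist (phi t x) p < d / 6) _ 0 t) => //.
  (* Fixed points near [phi u x] and [phi v x] are less than [d] apart, hence equal. *)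
  have step u v : `|u - v| < rho ->
      mdist (phi u x) p < d / 6 -> mdist (phi v x) p < d / 6.
    move=> uv up; have [q fq vq] := near_fix v.
    suff -> : p = q by [].
    apply: (fixed_isolated_eq d) => //.
    have := rhoP (u - v) (phi v x) uv; rewrite -flowD subrK => H.
    have := metric_triangle p (phi u x) q.
    have := metric_triangle (phi u x) (phi v x) q.
    by rewrite (metric_sym p (phi u x)); lra.
  by move=> u; exists rho => // v uv; split; apply: step; rewrite // distrC.
have xE : x = p by apply: isod => // t; have := stay t; lra.
have [z [a [a' [az a'z _]]]] := arcs 0.
have zp : z = p by rewrite -(flowK a z) az xE !fp.
apply: no_s; exists 0, 0; split; first by rewrite normr0.
by rewrite addr0 -a'z zp xE !fp.
Qed.

End Flow.

Theorem theorem1p3 (R : realType) (X : metricType R) (phi : R -> X -> X) :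
  compact [set: X] -> is_flow phi ->
  (expansive phi <-> kstar_expansive phi).
Proof.
by move=> cX flow; split; [exact: kstar_of_expansive|exact: expansive_of_kstar].
Qed.
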